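(* Let $X$ be an Archimedean pre-Riesz space with order unit. Then there exist a compact Hausdorff space $\Omega$ and a bipositive linear map $i\colon X\to C(\Omega)$ such that $i(X)$ is order dense in $C(\Omega)$. Moreover, for every positive linear functional $\phi$ on $X$ there exists a regular Borel measure $\mu$ on $\Omega$ such that $$\phi(x)=\int_\Omega i(x)(\omega)\,d\mu(\omega)\qquad\text{for all }x\in X.$$
   Context: All vector spaces are real. An ordered vector space $(X,K)$ is a vector space $X$ with a cone $K$ (that is, $\lambda x+\mu y\in K$ for all $x,y\in K$ and $\lambda,\mu\ge 0$, and $K\cap(-K)=\{0\}$) and the partial order $x\le y$ iff $y-x\in K$. It is Archimedean if for all $x,y\in X$ with $nx\le y$ for all $n\in\mathbb{N}$ one has $x\le 0$. For $x,y\in X$ let $\{x,y\}^{\mathrm{u}}=\{z\in X : z\ge x,\ z\ge y\}$. $X$ is a pre-Riesz space if for all $x,y,z\in X$ the inclusion $\{x+y,x+z\}^{\mathrm{u}}\subseteq\{y,z\}^{\mathrm{u}}$ implies $x\in K$. An element $u\ge 0$ of $X$ is an order unit if for every $x\in X$ there is $\lambda\ge 0$ with $-\lambda u\le x\le\lambda u$. A linear subspace $D$ of an ordered vector space $Y$ is order dense in $Y$ if $y=\inf\{d\in D : d\ge y\}$ for every $y\in Y$. A linear map $i\colon X\to Y$ between ordered vector spaces is bipositive if for every $x\in X$ one has $x\ge 0$ if and only if $i(x)\ge 0$. A linear functional $\phi$ on $X$ is positive if $\phi(x)\ge 0$ for all $x\ge 0$. $C(\Omega)$ is the space of real-valued continuous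 functions on $\Omega$ with the pointwise order. *)

(* Defs.v *)
From HB Require Import structures.
From mathcomp Require Import all_boot all_order all_algebra.
From mathcomp Require Import all_classical all_reals all_analysis.
Import Order.TTheory GRing.Theory Num.Theory.
Import numFieldNormedType.Exports.

Set Implicit Arguments.
Unset Strict Implicit.
Unset Printing Implicit Defensive.

Local Open Scope classical_set_scope.
Local Open Scope ring_scope.

Section ordered_vector_spaces.
Context (R : realType).

Section one_space.
Context (X : lmodType R) (K : set X).
Implicit Types (x y z u : X) (A D : set X).

Definition is_cone : Prop :=
  (forall x y (a b : R), K x -> K y -> 0 <= a -> 0 <= b ->
     K (a *: x + b *: y)) /\
  K `&` (-%R @` K) = [set 0].

Definition cone_le x y : Prop := K (y - x).

(* Allowing n = 0 as well would not change the notion: if n x <= y for all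
   n >= 1, then n x <= y - x for all n >= 0. *)
Definition archimedean_cone : Prop :=
  forall x y, (forall n : nat, (0 < n)%N -> cone_le (x *+ n) y) ->
    cone_le x 0.

Definition cone_ubound A : set X := [set z | forall a, A a -> cone_le a z].

Definition cone_lbound A : set X := [set z | forall a, A a -> cone_le z a].

Definition cone_inf A y : Prop :=
  cone_lbound A y /\ forall z, cone_lbound A z -> cone_le z y.

Definition pre_riesz : Prop :=
  forall x y z,
    cone_ubound [set x + y; x + z] `<=` cone_ubound [set y; z] -> K x.

Definition order_unit u : Prop :=
  K u /\ forall x, exists l : R,
    [/\ 0 <= l, cone_le (- (l *: u)) x & cone_le x (l *: u)].

(* Meant for D a linear subspace, e.g. the range of a linear map. *)
Definition order_dense D : Prop :=
  forall y, cone_inf [set d | D d /\ cone_le y d] y.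

Definition positive_functional (phi : X -> R) : Prop :=
  forall x, K x -> 0 <= phi x.

End one_space.

Definition bipositive (X Y : lmodType R) (K : set X) (L : set Y)
    (i : X -> Y) : Prop :=
  forall x, K x <-> L (i x).

End ordered_vector_spaces.

(* The vector space C(T), carried by the library's type of continuous
   functions, with pointwise operations. *)
Section continuous_functions.
Context (R : realType) (T : topologicalType).
Local Notation C := (continuousType T R).
Implicit Types (f g h : C) (a b : R).

Let zero_cts : continuous (fun _ : T => 0 : R).
Proof. by move=> x; exact: cvg_cst. Qed.

Let opp_cts f : continuous (fun x => - f x).
Proof. by move=> x; apply: cvgN; exact: cts_fun. Qed.

Let add_cts f g : continuous (fun x => f x + g x).
Proof. by move=> x; apply: cvgD; exact: cts_fun. Qed.

Let scale_cts a f : continuous (fun x => a * f x).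
Proof. by move=> x; apply: cvgM; [exact: cvg_cst|exact: cts_fun]. Qed.

Definition cfun0 : C := mkcts zero_cts.
Definition cfun_opp f : C := mkcts (opp_cts (f := f)).
Definition cfun_add f g : C := mkcts (add_cts (f := f) (g := g)).
Definition cfun_scale a f : C := mkcts (scale_cts (a := a) (f := f)).

Let addA : associative cfun_add.
Proof. by move=> f g h; apply/continuousEP => x; exact: addrA. Qed.

Let addC : commutative cfun_add.
Proof. by move=> f g; apply/continuousEP => x; exact: addrC. Qed.

Let add0 : left_id cfun0 cfun_add.
Proof. by move=> f; apply/continuousEP => x; exact: add0r. Qed.

Let addN : left_inverse cfun0 cfun_opp cfun_add.
Proof. by move=> f; apply/continuousEP => x; exact: addNr. Qed.

HB.instance Definition _ := GRing.isZmodule.Build C addA addC add0 addN.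

Let scaleA a b f : cfun_scale a (cfun_scale b f) = cfun_scale (a * b) f.
Proof. by apply/continuousEP => x; exact: mulrA. Qed.

Let scale1 : left_id 1 cfun_scale.
Proof. by move=> f; apply/continuousEP => x; exact: mul1r. Qed.

Let scaleDr : right_distributive cfun_scale +%R.
Proof. by move=> a f g; apply/continuousEP => x; exact: mulrDr. Qed.

Let scaleDl f : {morph cfun_scale^~ f : a b / a + b}.
Proof. by move=> a b; apply/continuousEP => x; exact: mulrDl. Qed.

HB.instance Definition _ :=
  GRing.Zmodule_isLmodule.Build R C scaleA scale1 scaleDr scaleDl.

Definition cfun_cone : set C := [set f | forall x, 0 <= f x].

End continuous_functions.

(* The library's measurable spaces and measures need a distinguished point,
   whereas T may be empty here: if X = {0} then T is necessarily empty.  Borel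
   measures are therefore plain set functions on T, only their values on Borel
   sets being relevant; the integral is the library's when T has a point (the
   choice of which is irrelevant) and 0 when T is empty. *)
Section borel.
Context (R : realType) (T : topologicalType).

Definition borel_set : set (set T) := <<s [set U : set T | open U] >>.

Definition borel_measure (mu : set T -> \bar R) : Prop :=
  [/\ mu set0 = 0%E,
      (forall A, borel_set A -> (0 <= mu A)%E) &
      (forall F : (set T)^nat, (forall n, borel_set (F n)) ->
         trivIset setT F ->
         mu (\bigcup_n F n) = (\sum_(0 <= n <oo) mu (F n))%E)].

Definition regular_borel_measure (mu : set T -> \bar R) : Prop :=
  [/\ borel_measure mu,
      (forall C, compact C -> (mu C < +oo)%E),
      (forall A, borel_set A ->
         mu A = ereal_inf [set mu U | U in [set U | open U /\ A `<=` U]]) &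
      (forall A, borel_set A ->
         mu A = ereal_sup [set mu C | C in [set C | compact C /\ C `<=` A]])].

Definition with_point (t : T) : Type := T.
HB.instance Definition _ (t : T) := Choice.on (with_point t).
HB.instance Definition _ (t : T) := isPointed.Build (with_point t) t.

Definition borel_type (t : T) :=
  g_sigma_algebraType ([set U : set T | open U] : set (set (with_point t))).

Definition borel_integral (mu : set T -> \bar R) (f : T -> \bar R) : \bar R :=
  if pselect (exists t : T, True) is left e then
    (\int[mu : set (borel_type (sval (cid e))) -> \bar R]_x f x)%E
  else 0%E.

End borel.

(* Main.v *)
Require Import Defs.
From HB Require Import structures.
From mathcomp Require Import all_boot all_order all_algebra.
From mathcomp Require Import all_classical all_reals all_analysis.
From mathcomp Require Import measurable_realfun ring lra.
Import Order.TTheory GRing.Theory Num.Theory.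
Import numFieldNormedType.Exports.

(** The space Omega consists of states, that is, of positive functionals with
    value 1 at a fixed order unit [u], with the topology of pointwise
    convergence, and [i x] is evaluation at [x].  The states form a compact
    space, and by a Hahn-Banach argument ([states_separate]) every [x] outside
    the cone is negative at some state.  Omega is a minimal closed set of states
    with this property ([minimal_detecting_set]); it makes [i] bipositive.

    Minimality yields order density ([order_dense_of_peaks]).  Every nonempty
    open subset V of Omega carries an [x] that is negative somewhere in V and
    nonnegative outside V.  Translated by its minimum and scaled by a large
    factor, [x] becomes an element of the range that vanishes at a point of V
    and is as large as desired outside V; with such elements one majorises a
    given continuous function y while staying close to y at a point of V.

    For the measure, a positive functional [phi] is transported to the range of
    [i] and extended to a positive functional L on all bounded functions on
    Omega ([positive_extension]), not only on the continuous ones.  The set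
    function sending A to the value of L at the indicator of A is then finitely
    additive on all subsets, and its regularisation, from inside by closed sets
    on open sets and from outside by open sets, is a regular Borel measure
    ([outer_content_regular]).  Slicing continuous functions horizontally
    identifies L with the integral ([layer_cake_eq]). *)

Set Implicit Arguments.
Unset Strict Implicit.
Unset Printing Implicit Defensive.

Local Open Scope classical_set_scope.
Local Open Scope ring_scope.

(** * States of ordered vector spaces *)

Section wedges.
Context (R : realType) (V : lmodType R).
Implicit Types (P Q : set V) (u x y : V).

Definition wedge P : Prop :=
  [/\ P 0, forall x y, P x -> P y -> P (x + y)
    & forall a x, 0 <= a -> P x -> P (a *: x)].

(** The vectors for which [u] acts as an order unit.  Keeping this domain
    explicit lets one extend functionals to the bounded functions without
    introducing a type of bounded functions. *)
Definition order_bounded P u : set V :=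
  [set y | exists l : R, P (l *: u - y) /\ P (l *: u + y)].

Lemma wedge_unit_le P u a b : wedge P -> P u -> ~ P (- u) ->
  P (a *: u - b *: u) -> b <= a.
Proof.
move=> [_ _ PZ] Pu Pnu; rewrite -scalerBl => Pab.
rewrite leNgt; apply/negP => ab; apply: Pnu.
have -> : - u = (b - a)^-1 *: ((a - b) *: u).
  by rewrite scalerA -(opprB b a) mulrN mulVf ?scaleN1r// subr_eq0 gt_eqF.
by apply: PZ => //; rewrite invr_ge0 subr_ge0 ltW.
Qed.

(** Zorn's lemma.  If [y] is not in a maximal [Q], then the wedge generated by
    [Q] and [y] contains [- u]; solving [- u = q + s *: y] for [y] shows that
    [- y] is strictly positive for [Q].  Hence [Q] is almost a half-space, and
    its boundary will be the kernel of a functional. *)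
Lemma maximal_wedge P u : wedge P -> ~ P (- u) ->
  exists Q, [/\ wedge Q, P `<=` Q, ~ Q (- u)
    & forall y, Q y \/ exists2 d, 0 < d & Q (- y - d *: u)].
Proof.
move=> wP Pnu.
pose good Q := [/\ wedge Q, P `<=` Q & ~ Q (- u)].
(* The empty set is admitted only because the union of the empty chain is
   empty. *)
have [|Q [goodQ maxQ]] := @Zorn_bigcup V [set Q | Q = set0 \/ good Q].
  move=> F Fgood Ftot.
  have [[Q0 [FQ0 Q00]]|nF] := pselect (exists Q, F Q /\ Q != set0); last first.
    left; apply: bigcup0 => A FA; apply/eqP/negPn/negP => A0.
    by apply: nF; exists A.
  have Fg A x : F A -> A x -> good A.
    by move=> FA Ax; have [A0|//] := Fgood _ FA; rewrite A0 in Ax.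
  have [x0 Q0x0] : Q0 !=set0 by exact/set0P.
  have [[Q00' _ _] PQ0 _] := Fg _ _ FQ0 Q0x0.
  right; split; first split.
  - by exists Q0.
  - move=> x y [A FA Ax] [B FB By].
    have [AB|BA] := Ftot _ _ FA FB.
      have [[_ BD _] _ _] := Fg _ _ FB By.
      by exists B => //; apply: BD => //; exact: AB.
    have [[_ AD _] _ _] := Fg _ _ FA Ax.
    by exists A => //; apply: AD => //; exact: BA.
  - move=> a x a0 [A FA Ax]; exists A => //.
    by have [[_ _ AZ] _ _] := Fg _ _ FA Ax; exact: AZ.
  - by move=> x Px; exists Q0 => //; exact: PQ0.
  - by move=> [A FA Au]; have [_ _] := Fg _ _ FA Au.
have {}goodQ : good Q.
  case: goodQ => // Q0; exfalso; apply: (maxQ P); last by right; split.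
  rewrite Q0; split=> // sub; apply: (sub 0).
  by case: wP.
exists Q; have [wQ PQ Qnu] := goodQ; split=> // y.
have [Q0 QD QZ] := wQ.
apply/or_asboolP; rewrite -implyNb; apply/implyP => /asboolPn Qy; apply/asboolP.
pose Q' := [set z | exists q s, [/\ Q q, 0 <= s & z = q + s *: y]].
have QQ' : Q `<=` Q'.
  by move=> q Qq; exists q, 0; split => //; rewrite scale0r addr0.
have wQ' : wedge Q'.
  split.
  - exact: QQ'.
  - move=> _ _ [q [s [Qq s0 ->]]] [q' [s' [Qq' s0' ->]]].
    exists (q + q'), (s + s'); split; [exact: QD|exact: addr_ge0|].
    by rewrite scalerDl addrACA.
  - move=> a _ a0 [q [s [Qq s0 ->]]]; exists (a *: q), (a * s).
    split; [exact: QZ|exact: mulr_ge0|by rewrite scalerDr scalerA].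
have [[q [s [Qq s0 nuE]]]|Q'nu] := pselect (Q' (- u)); last first.
  exfalso; apply: (maxQ Q').
    split=> // /(_ y) sub; apply: Qy; apply: sub.
    by exists 0, 1; rewrite scale1r add0r; split.
  by right; split => //; exact: subset_trans QQ'.
have {}s0 : 0 < s.
  rewrite lt_neqAle s0 andbT; apply/eqP => s0'; apply: Qnu.
  by rewrite nuE -s0' scale0r addr0.
exists s^-1; first by rewrite invr_gt0.
have -> : - y - s^-1 *: u = s^-1 *: q.
  rewrite -scalerN nuE scalerDr scalerA mulVf ?gt_eqF// scale1r.
  by rewrite addrCA addNr addr0.
by apply: QZ => //; rewrite invr_ge0 ltW.
Qed.

(** The form of the Hahn-Banach theorem from which every functional below is
    obtained.  For a maximal wedge [Q] the value at [y] is the unique [c] such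
    that [y - c *: u] is infinitesimal, that is, such that both
    [y - (c - e) *: u] and [(c + e) *: u - y] belong to [Q] for all [e > 0].
    This description is symmetric under [y |-> - y], so additivity and
    homogeneity follow by adding and scaling these memberships. *)
Lemma wedge_state P u : wedge P -> P u -> ~ P (- u) ->
  exists f : V -> R, [/\ f u = 1,
    forall x y, order_bounded P u x -> order_bounded P u y ->
      f (x + y) = f x + f y,
    forall a x, order_bounded P u x -> f (a *: x) = a * f x
    & forall x, order_bounded P u x -> P x -> 0 <= f x].
Proof.
move=> wP Pu Pnu.
have [Q [wQ PQ Qnu Qtot]] := maximal_wedge wP Pnu.
have [Q0 QD QZ] := wQ; have Qu := PQ _ Pu.
have Qle := wedge_unit_le wQ Qu Qnu.
have half (e : R) : 0 < e -> 0 < e / 2 by move=> e0; rewrite divr_gt0.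
pose val y c := forall e : R, 0 < e ->
  Q (y - (c - e) *: u) /\ Q ((c + e) *: u - y).
have val_uniq y c d : val y c -> val y d -> c = d.
  have le a b : val y a -> val y b -> a <= b.
    move=> ya yb; apply/ler_addgt0Pr => e e0.
    have [Qa _] := ya _ (half e e0).
    have [_ Qb] := yb _ (half e e0).
    have := QD _ _ Qb Qa; rewrite addrA subrK => /Qle.
    by lra.
  by move=> yc yd; apply/eqP; rewrite eq_le !le.
have valP y : order_bounded P u y -> exists c, val y c.
  move=> [l [/PQ Ql1 /PQ Ql2]].
  pose A := [set t | Q (y - t *: u)].
  have supA : has_sup A.
    split; first by exists (- l); rewrite /A/= scaleNr opprK addrC.
    exists l => t; rewrite /A/= => Qt; apply: Qle.
    by have := QD _ _ Ql1 Qt; rewrite addrA subrK.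
  exists (sup A) => e e0; split.
    have [t At ltt] := sup_adherent e0 supA.
    have -> : y - (sup A - e) *: u = (y - t *: u) + (t - (sup A - e)) *: u.
      by rewrite [(t - _) *: u]scalerBl addrA subrK.
    by apply: QD => //; apply: QZ => //; rewrite subr_ge0 ltW.
  have [Qy|[d d0 Qy]] := Qtot (y - (sup A + e) *: u).
    have : sup A + e <= sup A by apply: sup_upper_bound.
    by lra.
  have -> : (sup A + e) *: u - y = - (y - (sup A + e) *: u) - d *: u + d *: u.
    by rewrite subrK opprB.
  by apply: QD => //; apply: QZ => //; exact: ltW.
pose f y := xget 0 (val y).
have fE y c : val y c -> f y = c.
  by move=> yc; apply: val_uniq (yc); exact: (xgetPex 0 (ex_intro _ _ yc)).
have fP y : order_bounded P u y -> val y (f y).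
  by move=> /valP[c yc]; rewrite (fE _ _ yc).
exists f; split.
- apply: fE => e e0; rewrite scalerBl scalerDl scale1r opprB.
  rewrite addrC subrK [_ + _ *: u]addrC addrK.
  by split; apply: QZ => //; exact: ltW.
- move=> x y /fP Px /fP Py; apply: fE => e e0.
  have [x1 x2] := Px _ (half e e0).
  have [y1 y2] := Py _ (half e e0).
  split.
    have := QD _ _ x1 y1; rewrite addrACA -opprD -scalerDl.
    by congr (Q (_ - _ *: _)); field.
  have := QD _ _ x2 y2; rewrite addrACA -opprD -scalerDl.
  by congr (Q (_ *: _ - _)); field.
- move=> a x /fP Px; apply: fE => e e0.
  have [a0|a0|->] := ltrgtP a 0.
  + have na0 : 0 < - a by rewrite oppr_gt0.
    have [x1 x2] := Px _ (divr_gt0 e0 na0).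
    split.
      have := QZ _ _ (ltW na0) x2; congr (Q _).
      rewrite scalerBr scalerA [(- a) *: x]scaleNr opprK addrC.
      rewrite -[X in _ + X = _]opprK -scaleNr; congr (_ - _ *: _).
      by field; rewrite lt_eqF.
    have := QZ _ _ (ltW na0) x1; congr (Q _).
    rewrite scalerBr scalerA [(- a) *: x]scaleNr addrC.
    rewrite -scaleNr; congr (_ *: _ - _).
    by field; rewrite lt_eqF.
  + have [x1 x2] := Px _ (divr_gt0 e0 a0).
    split.
      have := QZ _ _ (ltW a0) x1; congr (Q _).
      rewrite scalerBr scalerA; congr (_ - _ *: _).
      by field; rewrite gt_eqF.
    have := QZ _ _ (ltW a0) x2; congr (Q _).
    rewrite scalerBr scalerA; congr (_ *: _ - _).
    by field; rewrite gt_eqF.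
  + rewrite mul0r scale0r !add0r subr0 scaleNr opprK.
    by split; apply: QZ => //; exact: ltW.
- move=> x /fP vx Px; apply/ler_addgt0Pr => e e0.
  have [_] := vx _ e0 => /QD/(_ (PQ _ Px)); rewrite subrK.
  by rewrite -[X in Q X]subr0 -(scale0r u) => /Qle.
Qed.

End wedges.

Section states.
Context (R : realType) (X : lmodType R) (K : set X) (u : X).
Hypotheses (hK : is_cone K) (hArch : archimedean_cone K) (hu : order_unit K u).
Implicit Types (x y : X).

Lemma cone_wedge : wedge K.
Proof.
have [KDZ K0] := hK; split.
- have : [set 0 : X] 0 by [].
  by rewrite -K0 => -[].
- by move=> x y Kx Ky; rewrite -(scale1r x) -(scale1r y); exact: KDZ.
- move=> a x a0 Kx; rewrite -(addr0 (a *: x)) -(scale0r x); exact: KDZ.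
Qed.

Lemma cone_antisym x : K x -> K (- x) -> x = 0.
Proof.
move=> Kx Knx; have [_ K0] := hK.
have : (K `&` (-%R @` K)) x by split => //; exists (- x) => //; rewrite opprK.
by rewrite K0.
Qed.

(** The one place where the Archimedean property enters: it makes the cone
    closed in the direction of the order unit. *)
Lemma cone_strict_gap x : ~ K x -> exists2 e : R, 0 < e & ~ K (x + e *: u).
Proof.
have [_ _ KZ] := cone_wedge.
move=> nKx; apply: contrapT => gap; apply: nKx.
rewrite -(opprK x) -[- _]add0r; apply: (hArch (y := u)) => n n0.
rewrite /cone_le mulNrn opprK.
have n0R : 0 < n%:R :> R by rewrite ltr0n.
have -> : u + x *+ n = n%:R *: (x + n%:R^-1 *: u).
  by rewrite scalerDr scalerA divff ?gt_eqF// scale1r scaler_nat addrC.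
apply: KZ; first exact: ltW.
apply: contrapT => nKn; apply: gap; exists n%:R^-1 => //.
by rewrite invr_gt0.
Qed.

Definition states : set (X -> R) := [set f | [/\ f u = 1,
  forall x y, f (x + y) = f x + f y, forall a x, f (a *: x) = a * f x
  & forall x, K x -> 0 <= f x]].

(** Adjoin [- (x + e *: u)] to the cone, where [x + e *: u] is outside it.  This
    does not make [- u] positive, since solving for [x + e *: u] would put it
    into the cone.  So there is a state that is nonnegative at
    [- (x + e *: u)], hence at most [- e] at [x]. *)
Lemma states_separate x : ~ K x -> exists2 f, states f & f x < 0.
Proof.
move=> nKx; have [e e0 nKe] := cone_strict_gap nKx.
have [K0 KD KZ] := cone_wedge; have [Ku Kbnd] := hu.
pose P := [set z | exists k (t : R),
  [/\ K k, 0 <= t & z = k - t *: (x + e *: u)]].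
have KP : K `<=` P.
  by move=> k Kk; exists k, 0; split=> //; rewrite scale0r subr0.
have wP : wedge P.
  split.
  - exact: KP.
  - move=> _ _ [k [t [Kk t0 ->]]] [k' [t' [Kk' t0' ->]]].
    exists (k + k'), (t + t'); split; [exact: KD|exact: addr_ge0|].
    by rewrite scalerDl opprD addrACA.
  - move=> a _ a0 [k [t [Kk t0 ->]]]; exists (a *: k), (a * t).
    split; [exact: KZ|exact: mulr_ge0|by rewrite scalerBr scalerA].
have Pnu : ~ P (- u).
  move=> [k [t [Kk t0 nuE]]].
  move: t0; rewrite le_eqVlt => /predU1P[t0|t0].
    have u0 : u = 0.
      by apply: cone_antisym => //; rewrite nuE -t0 scale0r subr0.
    have [l [_ _]] := Kbnd (- x).
    by rewrite /cone_le u0 scaler0 opprK add0r.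
  apply: nKe; have -> : x + e *: u = t^-1 *: (k + u).
    rewrite -[u in RHS]opprK nuE opprB [k + _]addrC subrK scalerA.
    by rewrite mulVf ?gt_eqF// scale1r.
  by apply: KZ; [rewrite invr_ge0 ltW|exact: KD].
have [f [fu fD fZ fP]] := wedge_state wP (KP _ Ku) Pnu.
have bnd y : order_bounded P u y.
  have [l [l0 lb ub]] := Kbnd y; exists l; split; apply: KP => //.
  by move: lb; rewrite /cone_le opprK addrC.
exists f.
  split => // [y z|a y|y Ky]; [exact: fD|exact: fZ|].
  by apply: fP => //; exact: KP.
have : 0 <= f ((-1) *: (x + e *: u)).
  by apply: fP => //; exists 0, 1; split=> //; rewrite scale1r add0r scaleN1r.
by rewrite fZ// fD// fZ// fu; lra.
Qed.

Lemma stateB f x y : states f -> f (x - y) = f x - f y.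
Proof. by move=> [_ fD fZ _]; rewrite fD -scaleN1r fZ mulN1r. Qed.

Lemma state_bounded x : exists l : R, forall f, states f -> `|f x| <= l.
Proof.
have [_ /(_ x)[l [l0 lb ub]]] := hu; exists l => f sf.
have [fu fD fZ fK] := sf; rewrite ler_norml.
have := fK _ lb; have := fK _ ub.
rewrite (stateB _ _ sf) opprK fD fZ fu; lra.
Qed.

End states.

(** * Compactness and continuity *)

Section subtype_compactness.
Context (Y : topologicalType) (A : set Y).

Lemma set_val_continuous : continuous (set_val : A -> Y).
Proof. exact: initial_continuous. Qed.

Lemma compact_set_type : compact A -> compact [set: A].
Proof.
move=> cA F PF _.
have FA : (set_val @ F) A.
  apply: (@filterS _ F _ setT); last exact: filterT.
  by move=> [y Ay] _; exact: set_mem.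
have [y [Ay Fy]] := cA (set_val @ F) _ FA.
exists (exist _ y (mem_set Ay)); split=> // N M FN.
rewrite nbhsE => -[_ [[W oW <-] Wy] WM].
have FvN : (set_val @ F) (@set_val Y A @` N).
  by apply: (@filterS _ F _ N) FN => p Np; exists p.
have [_ [[p Np <-] Wp]] := Fy _ W FvN (open_nbhs_nbhs (conj oW Wy)).
by exists p; split => //; exact: WM.
Qed.

Lemma hausdorff_set_type : hausdorff_space Y -> hausdorff_space A.
Proof.
move=> hY p q pq; apply/val_inj/hY => M N Mp Nq.
have [x [Mx Nx]] := pq _ _ (set_val_continuous Mp) (set_val_continuous Nq).
by exists (set_val x).
Qed.

End subtype_compactness.

(** A total chain of open sets that covers is directed, so one of its members
    already covers. *)
Lemma compact_chain_cover (Y : topologicalType) (C : set Y) (F : set (set Y)) :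
  compact C -> C !=set0 -> total_on F subset -> (forall U, F U -> open U) ->
  C `<=` \bigcup_(U in F) U -> exists2 U, F U & C `<=` U.
Proof.
move=> /compact_near_coveringP cC [y0 Cy0] Ftot oF CF.
have [U0 FU0 _] := CF _ Cy0.
pose G : set_system (set Y) := filter_from F (fun U => [set W | U `<=` W]).
have FG : Filter G.
  apply: filter_from_filter => [|U W FU FW]; first by exists U0.
  have [UW|WU] := Ftot _ _ FU FW.
    by exists W => // Z WZ; split=> //; exact: subset_trans WZ.
  by exists U => // Z UZ; split=> //; exact: subset_trans UZ.
(* The index in the near-covering property is a set [W]; the filter is generated
   by the families of all supersets of a member of the chain. *)
have [y Cy|U FU /(_ U) CU] := cC (set Y) G (fun U y => U y) FG.
  have [U FU Uy] := CF _ Cy.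
  exists (U, [set W | U `<=` W]) => /=.
    by split; [apply: open_nbhs_nbhs; split => //; exact: oF|exists U].
  by move=> [z W] [/= Uz UW]; exact: UW.
by exists U => //; apply: CU.
Qed.

Section continuous_real_functions.
Context (R : realType) (T : topologicalType).
Implicit Types g h : T -> R.

Lemma continuous_cst_fun (c : R) : continuous (fun _ : T => c).
Proof. by move=> t; exact: cvg_cst. Qed.

Lemma continuous_fun_add g h : continuous g -> continuous h ->
  continuous (fun t => g t + h t).
Proof. by move=> cg ch t; apply: cvgD; [exact: cg|exact: ch]. Qed.

Lemma continuous_fun_scale a h : continuous h -> continuous (fun t => a * h t).
Proof. by move=> ch t; apply: cvgMr; exact: ch. Qed.

Lemma closed_equalizer g h : continuous g -> continuous h ->
  closed [set t | g t = h t].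
Proof.
move=> cg ch.
have cgh : continuous (fun t => g t + -1 * h t).
  exact/continuous_fun_add/continuous_fun_scale.
have -> : [set t | g t = h t] = (fun t => g t + -1 * h t) @^-1` [set 0].
  apply/seteqP; split=> t /=; first by move=> ->; rewrite mulN1r subrr.
  by rewrite mulN1r => /eqP; rewrite subr_eq0 => /eqP.
have /continuous_closedP/(_ [set r | r = 0]) := cgh; apply; exact: closed_eq.
Qed.

End continuous_real_functions.

(** * A minimal closed set of states *)

Section state_space.
Context (R : realType) (X : lmodType R) (K : set X) (u : X).
Hypotheses (hK : is_cone K) (hArch : archimedean_cone K) (hu : order_unit K u).

Local Notation Y := {ptws X -> R}.
Local Notation S := (states K u : set Y).

Lemma continuous_evaluation x : continuous (fun f : Y => f x).
Proof. exact: (@proj_continuous X (fun=> R) x). Qed.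

Lemma closed_states : closed S.
Proof.
have -> : S = [set f : Y | f u = 1]
   `&` \bigcap_xy [set f : Y | f (xy.1 + xy.2) = f xy.1 + f xy.2]
   `&` \bigcap_ax [set f : Y | f (ax.1 *: ax.2) = ax.1 * f ax.2]
   `&` \bigcap_(x in K) [set f : Y | 0 <= f x].
  apply/seteqP; split=> f /=.
    move=> [fu fD fZ fK]; split; last by move=> x; exact: fK.
    split; last by move=> [a x] _; exact: fZ.
    by split=> // -[x y] _; exact: fD.
  move=> [[[fu fD] fZ] fK]; split => //.
  - by move=> x y; exact: (fD (x, y)).
  - by move=> a x; exact: (fZ (a, x)).
apply: closedI; first apply: closedI; first apply: closedI.
- apply: (@closed_equalizer R Y (fun f => f u) (fun=> 1)).
    exact: continuous_evaluation.
  exact: (@continuous_cst_fun R Y).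
- apply: closed_bigI => -[x y] _.
  apply: (@closed_equalizer R Y (fun f => f (x + y)) (fun f => f x + f y)).
    exact: continuous_evaluation.
  by apply: (@continuous_fun_add R Y); exact: continuous_evaluation.
- apply: closed_bigI => -[a x] _.
  apply: (@closed_equalizer R Y (fun f => f (a *: x)) (fun f => a * f x)).
    exact: continuous_evaluation.
  by apply: (@continuous_fun_scale R Y); exact: continuous_evaluation.
- apply: closed_bigI => x _.
  have /continuous_closedP/(_ [set r | 0 <= r]) := @continuous_evaluation x.
  by apply; exact: closed_ge.
Qed.

Lemma compact_states : compact S.
Proof.
have /choice[l lP] := state_bounded hu.
have := @tychonoff X (fun=> R) (fun x => `[- l x, l x]%classic).
move=> /(_ (fun x => @segment_compact _ _ _)) cP.
apply: subclosed_compact closed_states cP _ => f Sf x /=.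
by rewrite in_itv/= -ler_norml; exact: lP.
Qed.

Definition detects (B : set Y) : Prop :=
  forall x, ~ K x -> exists2 f, B f & f x < 0.

(** A minimal closed set of states that determines the cone, given by its open
    complement [U].  Zorn's lemma applies because the union of a chain of
    admissible complements is admissible: for [x] outside the cone take [e > 0]
    with [x + e *: u] outside it as well; if no state outside the union were
    negative at [x], the union would cover the compact set of the states that
    are at most [- e] at [x], hence so would a single member, whose complement
    then would not detect [x + e *: u].  Minimality gives the last clause: a
    relatively open set cannot be dropped, because of some [x] that is negative
    only on it. *)
Lemma minimal_detecting_set : exists U : set Y, [/\ open U, detects (S `\` U)
  & forall W, open W -> (S `\` U) `&` W !=set0 ->
    exists2 x, ~ K x & forall f, (S `\` U) f -> ~ W f -> 0 <= f x].
Proof.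
have [|U [[oU dU] Umax]] :=
  @Zorn_bigcup Y [set U | open U /\ detects (S `\` U)].
  move=> F FP Ftot; split; first by apply: bigcup_open => U /FP[].
  move=> x nKx; have [e e0 nKe] := cone_strict_gap u hK hArch nKx.
  have low f : S f -> f (x + e *: u) < 0 -> f x <= - e.
    by move=> [fu fD fZ _]; rewrite fD fZ fu; lra.
  pose C := S `&` [set f : Y | f x <= - e].
  suff [f [Sf fx] nFf] : exists2 f, C f & ~ (\bigcup_(U in F) U) f.
    by exists f; [split|apply: le_lt_trans fx _; rewrite oppr_lt0].
  apply: contrapT => nC.
  have CF : C `<=` \bigcup_(U in F) U.
    by move=> f Cf; apply: contrapT => nf; apply: nC; exists f.
  have cC : compact C.
    apply: compact_closedI; first exact: compact_states.
    have /continuous_closedP/(_ [set r | r <= - e]) := @continuous_evaluation x.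
    by apply; exact: closed_le.
  have [f0 Sf0 f0x] := states_separate hK hArch hu nKe.
  have C0 : C !=set0 by exists f0; split => //; exact: low.
  have [U FU CU] := compact_chain_cover cC C0 Ftot (fun U FU => (FP U FU).1) CF.
  have [f [Sf nUf] fx] := (FP U FU).2 _ nKe.
  by apply: nUf; apply: CU; split => //; exact: low.
exists U; split => // W oW [f [[Sf nUf] Wf]].
apply: contrapT => noX; apply: (Umax (U `|` W)).
  by split => // /(_ f) UWf; apply: nUf; apply: UWf; right.
split; first exact: openU.
move=> x nKx; apply: contrapT => nof; apply: noX; exists x => // g [Sg nUg] nWg.
rewrite leNgt; apply/negP => gx; apply: nof; exists g => //; split => //.
by case.
Qed.

End state_space.

(** * Order density *)

Section order_density.
Context (R : realType) (T : topologicalType) (X : lmodType R)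
  (i : {linear X -> continuousType T R}) (u : X).
Hypotheses (cT : compact [set: T]) (iu : forall t, i u t = 1).

(** Suppose that a lower bound [z] of the majorants of [y] in the range exceeds
    [y] at some point.  Then [y < c < z] on a nonempty open [V], for some
    constant [c].  Let [x] be negative somewhere but only in [V], and let [mn]
    be its minimum, attained at [s] in [V].  The function [x - mn *: u] is
    nonnegative, vanishes at [s] and is at least [- mn > 0] outside [V]; so for
    [M] large [c *: u + M *: (x - mn *: u)] majorises [y] everywhere, while its
    value at [s] is [c < z s]. *)
Lemma order_dense_of_peaks :
  (forall V : set T, open V -> V !=set0 ->
     exists2 x, (exists t, i x t < 0) & forall t, ~ V t -> 0 <= i x t) ->
  order_dense (cfun_cone (R := R) (T := T)) (range i).
Proof.
move=> peaks y; split; first by move=> d [].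
move=> z zlb t; rewrite -[X in 0 <= X]/(y t - z t) subr_ge0 leNgt.
apply/negP => yz.
pose c := (y t + z t) / 2.
pose V := [set s | y s < c] `&` [set s | c < z s].
have oV : open V.
  apply: openI.
    have cy := @cts_fun _ _ (y : continuousType T R).
    by have /continuousP/(_ [set r | r < c]) := cy; apply; exact: open_lt.
  have cz := @cts_fun _ _ (z : continuousType T R).
  by have /continuousP/(_ [set r | c < r]) := cz; apply; exact: open_gt.
have [|x [s0 xs0] xV] := peaks V oV.
  by exists t; split; rewrite /c/=; lra.
have T0 : [set: T] !=set0 by exists t.
have wcts (f : continuousType T R) : {within [set: T], continuous f}.
  exact/continuous_subspaceT/cts_fun.
have [s _ smin] := compact_EVT_min T0 cT (wcts (i x)).
have [s' _ smax] := compact_EVT_max T0 cT (wcts y).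
pose mn := i x s.
have mn0 : mn < 0 by apply: le_lt_trans xs0; apply: smin; rewrite inE.
have Vs : V s by apply: contrapT => /xV; rewrite leNgt mn0.
pose M := (`|y s'| + `|c|) / - mn.
have M0 : 0 <= M by rewrite divr_ge0 ?addr_ge0// oppr_ge0 ltW.
pose d := i (c *: u + M *: (x - mn *: u)).
have dE r : d r = c + M * (i x r - mn).
  have iD x1 x2 : i (x1 + x2) r = i x1 r + i x2 r by rewrite linearD.
  have iN x1 : i (- x1) r = - i x1 r by rewrite linearN.
  have iZ a x1 : i (a *: x1) r = a * i x1 r by rewrite linearZ.
  by rewrite /d !(iD, iN, iZ) iu; ring.
have yd : forall r, y r <= d r.
  move=> r; rewrite dE; have [[yr _]|nVr] := pselect (V r).
    rewrite (le_trans (ltW yr))// lerDl mulr_ge0// subr_ge0.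
    by apply: smin; rewrite inE.
  have yr : y r <= `|y s'|.
    by apply: le_trans (ler_norm _); apply: smax; rewrite inE.
  have : M * - mn <= M * (i x r - mn) by rewrite ler_wpM2l// lerDr xV.
  rewrite {1}/M divfK; last by rewrite oppr_eq0 lt_eqF.
  by have := ler_norm (- c); rewrite normrN; lra.
have : d s < z s by rewrite dE subrr mulr0 addr0; case: Vs.
rewrite ltNge => /negP; apply.
have /(_ s) : cfun_cone (d - z).
  by apply: zlb; split; [exists (c *: u + M *: (x - mn *: u))|
    move=> r; rewrite -[X in 0 <= X]/(d r - y r) subr_ge0].
by rewrite -[X in 0 <= X -> _]/(d s - z s) subr_ge0.
Qed.

End order_density.

(** * Regularisation of finitely additive contents *)

Section content.
Context (R : realType) (T : topologicalType) (m : set T -> R).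
Hypotheses (hT : hausdorff_space T) (cT : compact [set: T]).
Hypotheses (m_ge0 : forall A, 0 <= m A)
  (mU : forall A B, A `&` B = set0 -> m (A `|` B) = m A + m B).
Implicit Types (A B C D U V : set T).

Local Open Scope ereal_scope.

(** A finitely additive [m] need be neither countably additive nor regular.
    Measuring open sets from inside by closed sets, then all sets from outside
    by open sets, produces a regular measure with the same total mass. *)
Definition inner_content U : \bar R :=
  ereal_sup [set (m C)%:E | C in [set C | closed C /\ C `<=` U]].

Definition outer_content A : \bar R :=
  ereal_inf [set inner_content U | U in [set U | open U /\ A `<=` U]].

Local Notation inner := inner_content.
Local Notation outer := outer_content.

Lemma content0 : m set0 = 0%R.
Proof. by have := mU (setI0 set0); rewrite setU0; lra. Qed.

Lemma le_content A B : A `<=` B -> (m A <= m B)%R.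
Proof.
move=> AB; rewrite -(setDUK AB) mU ?lerDl//.
by rewrite setDE setICA setICr setI0.
Qed.

Lemma contentU_le A B : (m (A `|` B) <= m A + m B)%R.
Proof.
have -> : A `|` B = A `|` (B `\` A) by rewrite setDE setUIr setUCr setIT.
rewrite mU; last by rewrite setDE setICA setICr setI0.
by rewrite lerD2l; apply: le_content; exact: subDsetl.
Qed.

Lemma le_inner_content C U : closed C -> C `<=` U -> (m C)%:E <= inner U.
Proof. by move=> cC CU; apply: ereal_sup_ubound; exists C. Qed.

Lemma inner_content_ge0 U : 0 <= inner U.
Proof.
have := le_inner_content closed0 (sub0set U).
by rewrite content0.
Qed.

Lemma inner_content_le U V : U `<=` V -> inner U <= inner V.
Proof.
move=> UV; apply: le_ereal_sup => _ [C [cC CU] <-].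
by exists C => //; split => //; exact: subset_trans UV.
Qed.

Lemma inner_content_leT U : inner U <= (m setT)%:E.
Proof.
by apply/ereal_supP => _ [C _ <-]; rewrite lee_fin; exact: le_content.
Qed.

Lemma inner_contentT : inner setT = (m setT)%:E.
Proof.
apply/eqP; rewrite eq_le inner_content_leT/=.
by apply: le_inner_content => //; exact: closedT.
Qed.

(** By normality some open [W] satisfies [C `\` V `<=` W] and
    [closure W `<=` U]; cut [C] along [W]. *)
Lemma closed_split_cover C U V : closed C -> open U -> open V ->
  C `<=` U `|` V ->
  exists C1 C2, [/\ closed C1, closed C2, C1 `<=` U, C2 `<=` V & C = C1 `|` C2].
Proof.
move=> cC oU oV CUV.
have cD : closed (C `&` ~` V) by apply: closedI => //; exact: open_closedC.
have /(compact_normal hT cT cD)[N] : set_nbhs (C `&` ~` V) U.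
  by apply/set_nbhsP; exists U; split => // x [/CUV[]].
move=> /set_nbhsP[W [oW DW WN]] NU.
exists (C `&` closure N), (C `&` ~` W); split.
- by apply: closedI => //; exact: closed_closure.
- by apply: closedI => //; exact: open_closedC.
- by move=> x [_ /NU].
- by move=> x [Cx Wx]; apply: contrapT => Vx; apply: Wx; apply: DW.
- rewrite -setIUr; apply/seteqP; split=> [x Cx|x []//]; split => //.
  have [Wx|] := pselect (W x); last by right.
  by left; apply: subset_closure; exact: WN.
Qed.

Lemma inner_contentU_le U V : open U -> open V ->
  inner (U `|` V) <= inner U + inner V.
Proof.
move=> oU oV; apply/ereal_supP => _ [C [cC CUV] <-].
have [C1 [C2 [cC1 cC2 C1U C2V ->]]] := closed_split_cover cC oU oV CUV.
apply: (@le_trans _ _ ((m C1)%:E + (m C2)%:E)).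
  by rewrite -EFinD lee_fin; exact: contentU_le.
by apply: leeD; exact: le_inner_content.
Qed.

Lemma inner_content_bigsetU_le (U : (set T)^nat) n : (forall k, open (U k)) ->
  inner (\big[setU/set0]_(k < n) U k) <= \sum_(0 <= k < n) inner (U k).
Proof.
move=> oU; elim: n => [|n ih].
  rewrite big_ord0 big_geq//; apply/ereal_supP => _ [C [_ C0] <-].
  by rewrite subset0 in C0; rewrite C0 content0.
rewrite big_ord_recr big_nat_recr//=.
apply: (le_trans (inner_contentU_le _ _)) => //.
  by rewrite -bigcup_mkord; exact: bigcup_open.
by apply: leeD.
Qed.

Lemma closed_finite_subcover C (U : (set T)^nat) : closed C ->
  (forall k, open (U k)) -> C `<=` \bigcup_k U k ->
  exists n, C `<=` \big[setU/set0]_(k < n) U k.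
Proof.
move=> cC oU CU.
have /compact_near_coveringP : compact C by exact: subclosed_compact cC cT _.
move=> /(_ nat \oo (fun n x => exists2 k, (k < n)%N & U k x)).
have cvr x : C x ->
    \forall x' \near x & n \near \oo, exists2 k, (k < n)%N & U k x'.
  move=> /CU[k _ Ukx]; exists (U k, [set n | (k < n)%N]) => /=.
    by split; [exact: open_nbhs_nbhs|exact: nbhs_infty_gt].
  by move=> [x' n] [/= Ukx' kn]; exists k.
move=> /(_ _ cvr)[n _ /(_ n (leqnn n)) Cn]; exists n => x /Cn[k kn Ukx].
by rewrite -bigcup_mkord; exists k.
Qed.

(** Compactness turns finite subadditivity into countable subadditivity: each
    closed subset of a countable union of open sets lies in a finite one. *)
Lemma inner_content_bigcup_le (U : (set T)^nat) : (forall k, open (U k)) ->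
  inner (\bigcup_k U k) <= \sum_(k <oo) inner (U k).
Proof.
move=> oU; apply/ereal_supP => _ [C [cC CU] <-].
have [n Cn] := closed_finite_subcover cC oU CU.
apply: (le_trans (le_inner_content cC Cn)).
apply: (le_trans (inner_content_bigsetU_le _ oU)).
by apply: nneseries_lim_ge => *; exact: inner_content_ge0.
Qed.

Lemma outer_content_open U : open U -> outer U = inner U.
Proof.
move=> oU; apply/eqP; rewrite eq_le; apply/andP; split.
  by apply: ereal_inf_lbound; exists U => //; split.
by apply/ereal_infP => _ [V [_ UV] <-]; exact: inner_content_le.
Qed.

Lemma outer_content_ge0 A : 0 <= outer A.
Proof. by apply/ereal_infP => _ [U _ <-]; exact: inner_content_ge0. Qed.

Lemma outer_content_le A B : A `<=` B -> outer A <= outer B.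
Proof.
move=> AB; apply/ereal_infP => _ [U [oU BU] <-].
by apply: ereal_inf_lbound; exists U => //; split => //; exact: subset_trans BU.
Qed.

Lemma outer_contentT : outer setT = (m setT)%:E.
Proof. by rewrite outer_content_open ?inner_contentT//; exact: openT. Qed.

Lemma outer_content_fin_num A : outer A \is a fin_num.
Proof.
rewrite ge0_fin_numE ?outer_content_ge0//.
rewrite (le_lt_trans (outer_content_le (@subsetT _ A)))//.
by rewrite outer_contentT ltry.
Qed.

Lemma outer_content0 : outer set0 = 0.
Proof.
rewrite outer_content_open; last exact: open0.
apply/eqP; rewrite eq_le inner_content_ge0 andbT.
apply/ereal_supP => _ [C [_ C0] <-].
by rewrite subset0 in C0; rewrite C0 content0.
Qed.

Lemma outer_content_adherent A (e : R) : (0 < e)%R ->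
  exists U, [/\ open U, A `<=` U & inner U <= outer A + e%:E].
Proof.
move=> e0; have [_ [U [oU AU] <-] /ltW Ue] :=
  lb_ereal_inf_adherent e0 (outer_content_fin_num A).
by exists U.
Qed.

Lemma outer_content_sigma_subadditive : sigma_subadditive outer.
Proof.
move=> A; apply/lee_addgt0Pr => e e0.
have en n : (0 < e / (2 ^ n.+1)%:R)%R by rewrite divr_gt0// ltr0n expn_gt0.
have /choice[U UP] n := outer_content_adherent (A n) (en n).
apply: le_trans (epsilon_trick _ _ (ltW e0)); last first.
  by move=> n; exact: outer_content_ge0.
apply: (@le_trans _ _ (inner (\bigcup_n U n))).
  apply: ereal_inf_lbound; exists (\bigcup_n U n) => //; split.
    by apply: bigcup_open => n _; have [] := UP n.
  by apply: subset_bigcup => n _; have [] := UP n.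
apply: (@le_trans _ _ (\sum_(n <oo) inner (U n))).
  by apply: inner_content_bigcup_le => n; have [] := UP n.
by apply: lee_nneseries => n *; [exact: inner_content_ge0|have [] := UP n].
Qed.

HB.instance Definition _ := isOuterMeasure.Build R T outer
  outer_content0 outer_content_ge0 outer_content_le
  outer_content_sigma_subadditive.

(** It suffices to split an open [V] by [U].  If [C] is closed in [V `&` U] and
    [D] is closed in [V `\` C], then [m C + m D = m (C `|` D)] is at most the
    inner content of [V]; take the supremum over [D], then over [C]. *)
Lemma open_caratheodory U : open U -> caratheodory_measurable outer U.
Proof.
move=> oU; apply: le_caratheodory_measurable => X.
apply/ereal_infP => _ [V [oV XV] <-].
apply: (@le_trans _ _ (outer (V `&` U) + outer (V `&` ~` U))).
  by apply: leeD; apply: outer_content_le; exact: setSI.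
rewrite outer_content_open; last exact: openI.
rewrite -leeBrDr ?outer_content_fin_num//.
apply/ereal_supP => _ [C [cC CVU] <-].
rewrite leeBrDr ?outer_content_fin_num// addeC -leeBrDr//.
have oVC : open (V `&` ~` C) by apply: openI => //; exact: closed_openC.
apply: (@le_trans _ _ (inner (V `&` ~` C))).
  rewrite -outer_content_open//; apply: outer_content_le; apply: setIS.
  by apply: subsetC => x /CVU[].
apply/ereal_supP => _ [D [cD DVC] <-].
rewrite leeBrDr// -EFinD -mU; last first.
  by apply/seteqP; split => // x [/DVC[]].
apply: le_inner_content; first exact: closedU.
by rewrite subUset; split => x; [case/DVC|case/CVU].
Qed.

Lemma borel_caratheodory A : borel_set A -> caratheodory_measurable outer A.
Proof.
apply: smallest_sub => [|U]; last exact: open_caratheodory.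
split; first exact: caratheodory_measurable_set0.
- by move=> B mB; rewrite setTD; exact: caratheodory_measurable_setC.
- by move=> F mF; exact: caratheodory_measurable_bigcup.
Qed.

Lemma outer_content_borel_measure : borel_measure outer.
Proof.
split; [exact: outer_content0|by move=> A _; exact: outer_content_ge0|].
move=> F bF tF; apply/eqP; rewrite eq_le; apply/andP; split.
  exact: outer_content_sigma_subadditive.
have := caratheodory_lime_le (mu := outer)
  (fun n => borel_caratheodory (bF n)) tF (\bigcup_n F n).
rewrite setICr outer_measure0 adde0; apply: le_trans.
rewrite le_eqVlt; apply/orP; left; apply/eqP; apply: eq_eseriesr => n _.
by congr outer; apply/esym/setIidr; exact: bigcup_sup.
Qed.

(** Outer regularity is built in.  Since the total mass is finite, inner
    regularity of [A] is outer regularity of the complement of [A]. *)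
Lemma outer_content_regular : regular_borel_measure outer.
Proof.
split; first exact: outer_content_borel_measure.
- by move=> C _; rewrite ltey_eq outer_content_fin_num.
- move=> A _; congr ereal_inf; apply/seteqP; split => _ [U [oU AU] <-].
    by exists U => //; rewrite outer_content_open.
  by exists U => //; rewrite outer_content_open.
- move=> A bA; apply/eqP; rewrite eq_le; apply/andP; split; last first.
    by apply/ereal_supP => _ [C [_ CA] <-]; exact: outer_content_le.
  apply/lee_addgt0Pr => e e0.
  have [U [oU AU Ue]] := outer_content_adherent (~` A) e0.
  have mA := borel_caratheodory bA setT.
  have mU' := open_caratheodory oU setT.
  rewrite !setTI in mA mU'.
  have cU : closed (~` U) by exact: open_closedC.
  apply: (@le_trans _ _ (outer (~` U) + e%:E)); last first.
    rewrite leeD2r//; apply: ereal_sup_ubound; exists (~` U) => //; split.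
      exact: subclosed_compact cU cT _.
    by move=> x nUx; apply: contrapT => /AU.
  rewrite -(leeD2rE _ _ (outer_content_fin_num (~` A))) -mA mU'.
  by rewrite (outer_content_open oU) addeC -addeA leeD2l// addeC.
Qed.

End content.

(** * Comparison of functionals by horizontal slicing *)

Section layer_cake.
Context (R : realType) (T : topologicalType).
Implicit Types (f g : T -> R) (L I : (T -> R) -> R).

Definition linear_on_continuous L : Prop := forall a f g,
  continuous f -> continuous g ->
  L (fun t => a * f t + g t) = a * L f + L g.

Definition unit_valued f : Prop := forall t, 0 <= f t <= 1.

(** The nearest point of the unit interval, in a form that makes continuity
    immediate. *)
Definition clamp (y : R) : R := (`|y| - `|y - 1| + 1) / 2.

Lemma clampE y : clamp y = if y <= 0 then 0 else if y <= 1 then y else 1.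
Proof.
rewrite /clamp; case: (leP y 0) => [y0|y0].
  by rewrite ler0_norm// ler0_norm//; lra.
case: (leP y 1) => [y1|y1]; rewrite gtr0_norm//.
  by rewrite ler0_norm//; lra.
by rewrite ger0_norm//; lra.
Qed.

Lemma clamp_itv y : 0 <= clamp y <= 1.
Proof.
by rewrite clampE; case: (leP y 0) => ?; [|case: (leP y 1) => ?]; lra.
Qed.

Lemma sum_clamp y n : 0 <= y ->
  \sum_(k < n) clamp (y - k%:R) = if y <= n%:R then y else n%:R.
Proof.
move=> y0; elim: n => [|n ih].
  by rewrite big_ord0; case: ifPn => // *; lra.
rewrite big_ord_recr/= ih clampE -natr1.
case: (leP y n%:R) => ?; case: (leP y (n%:R + 1)) => ?;
  case: (leP (y - n%:R) 0) => ?; try lra;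
  by case: (leP (y - n%:R) 1) => ?; lra.
Qed.

Lemma continuous_clamp : continuous clamp.
Proof.
move=> y; apply: cvgMl; apply: cvgD; last exact: cvg_cst.
apply: cvgB; first exact: norm_continuous.
apply: cvg_norm; apply: cvgB; [exact: cvg_id|exact: cvg_cst].
Qed.

Lemma continuous_affine a b f : continuous f ->
  continuous (fun t => a * f t + b).
Proof.
move=> cf; apply: continuous_fun_add; first exact: continuous_fun_scale.
exact: continuous_cst_fun.
Qed.

Lemma linear_on_continuous0 L : linear_on_continuous L -> L (fun=> 0) = 0.
Proof.
have c0 := @continuous_cst_fun R T 0.
move=> lL; have := lL 1 _ _ c0 c0.
by under eq_fun do rewrite mul1r addr0; rewrite mul1r; lra.
Qed.

Lemma linear_on_continuous_affine L a b f : linear_on_continuous L ->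
  continuous f -> L (fun t => a * f t + b) = a * L f + b * L (fun=> 1).
Proof.
move=> lL cf; rewrite lL//; last exact: continuous_cst_fun.
congr (_ + _).
have := lL b _ _ (@continuous_cst_fun R T 1) (@continuous_cst_fun R T 0).
rewrite (linear_on_continuous0 lL) [RHS]addr0 => <-; congr L.
by apply/funext => t; rewrite mulr1 addr0.
Qed.

Lemma linear_on_continuous_sum L n (g : nat -> T -> R) :
  linear_on_continuous L -> (forall k, continuous (g k)) ->
  L (fun t => \sum_(k < n) g k t) = \sum_(k < n) L (g k).
Proof.
move=> lL cg; elim: n => [|n ih].
  under eq_fun do rewrite big_ord0.
  by rewrite big_ord0 linear_on_continuous0.
rewrite big_ord_recr/= -ih.
have cs : continuous (fun t => \sum_(k < n) g k t).
  elim: n {ih} => [|n ih].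
    by under eq_fun do rewrite big_ord0; exact: continuous_cst_fun.
  under eq_fun do rewrite big_ord_recr/=.
  exact: continuous_fun_add.
have := lL 1 _ _ cs (cg n); rewrite mul1r => <-; congr L.
by apply/funext => t; rewrite big_ord_recr mul1r.
Qed.

Section comparison.
Variables L I : (T -> R) -> R.
Hypotheses (lL : linear_on_continuous L) (lI : linear_on_continuous I).
Hypothesis LI : forall f g, continuous f -> continuous g ->
  unit_valued f -> unit_valued g -> (forall t, f t != 0 -> g t = 1) ->
  L f <= I g.

Let u1 : unit_valued (fun _ : T => 1 : R).
Proof. by move=> t; rewrite ler01 lexx. Qed.

Let u0 : unit_valued (fun _ : T => 0 : R).
Proof. by move=> t; rewrite ler01 lexx. Qed.

(** Cut [n.+1 * f] into the slices [g k = clamp (n.+1 * f - k)] for [k <= n].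
    Where [g k.+1] does not vanish, [g k] equals 1; hence, by hypothesis,
    [L (g k.+1) <= I (g k)], and [L (g 0) <= I 1].  Summing over [k],
    with [0 <= I (g n)], gives
    [n.+1 * L f <= I 1 + n.+1 * I f], and [n] is arbitrary. *)
Lemma layer_cake_le f : continuous f -> unit_valued f -> L f <= I f.
Proof.
move=> cf uf.
suff slices n : n.+1%:R * L f <= I (fun=> 1) + n.+1%:R * I f.
  rewrite leNgt -subr_gt0; apply/negP => d0.
  have := archi_boundP (normr_ge0 (I (fun=> 1) / (L f - I f))).
  set n := Num.bound _ => /(le_lt_trans (ler_norm _)).
  rewrite ltr_pdivrMr// => nP.
  have := slices n; rewrite -natr1; nra.
pose g k t := clamp (n.+1%:R * f t - k%:R).
have cg k : continuous (g k).
  move=> t.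
  apply: (@continuous_comp _ _ _ (fun t => n.+1%:R * f t - k%:R) clamp).
    exact: continuous_affine.
  exact: continuous_clamp.
have ug k : unit_valued (g k) by move=> t; exact: clamp_itv.
have nf : (fun t => n.+1%:R * f t + 0) = (fun t => \sum_(k < n.+1) g k t).
  apply/funext => t; have /andP[f0 f1] := uf t.
  rewrite sum_clamp ?mulr_ge0// addr0 ifT//.
  by rewrite -[leRHS]mulr1 ler_wpM2l.
have LE := linear_on_continuous_sum n.+1 lL cg.
have IE := linear_on_continuous_sum n.+1 lI cg.
rewrite -nf linear_on_continuous_affine// mul0r addr0 in LE.
rewrite -nf linear_on_continuous_affine// mul0r addr0 in IE.
rewrite LE IE big_ord_recl [in leRHS]big_ord_recr/=; apply: lerD.
  by apply: LI => //; exact: continuous_cst_fun.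
rewrite -[leLHS]addr0; apply: lerD; last first.
  rewrite -(linear_on_continuous0 lL).
  by apply: LI => // [|t]; [exact: continuous_cst_fun|rewrite eqxx].
apply: ler_sum => k _; apply: LI => // t.
rewrite /g /bump/= add1n -natr1 !clampE; set y := _ * _.
case: (leP (y - _) 0) => [?|y1 _]; first by rewrite eqxx.
case: (leP (y - _) 0) => [?|?]; first by lra.
by case: (leP (y - _) 1) => [?|//]; lra.
Qed.

(** Once the total masses agree, the inequality for unit-valued functions may be
    applied to affine images of both [f] and [- f], which gives equality. *)
Lemma layer_cake_eq f (c : R) : I (fun=> 1) <= L (fun=> 1) ->
  continuous f -> (forall t, `|f t| <= c) -> L f = I f.
Proof.
move=> I1 cf fc.
have L1 : L (fun=> 1) = I (fun=> 1).
  apply/eqP; rewrite eq_le I1 andbT.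
  by apply: LI => //; exact: continuous_cst_fun.
have [c0|c0] := ltP c 0.
  have noT (t : T) : False.
    by have := le_lt_trans (fc t) c0; rewrite ltNge normr_ge0.
  have -> : f = fun=> 1 by apply/funext => t; case: (noT t).
  exact: L1.
(* The map [y |-> d * y + 1 / 2] sends the interval from [- c] to [c] into the
   unit interval. *)
pose d := (2 * (c + 1))^-1; have d0 : 0 < d by rewrite invr_gt0; lra.
have le s : `|s| = 1 -> s * L f <= s * I f.
  move=> s1.
  have uf : unit_valued (fun t => d * s * f t + 2^-1).
    move=> t; have : `|s * f t| <= c by rewrite normrM s1 mul1r.
    rewrite ler_norml -mulrA => /andP[h1 h2].
    have d2 : d * (c + 1) = 2^-1 by rewrite /d; field; lra.
    have : d * - (c + 1) <= d * (s * f t) by rewrite ler_pM2l//; lra.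
    have : d * (s * f t) <= d * (c + 1) by rewrite ler_pM2l//; lra.
    by rewrite mulrN d2; lra.
  have := layer_cake_le (@continuous_affine (d * s) 2^-1 _ cf) uf.
  by rewrite !linear_on_continuous_affine// L1 lerD2r -!mulrA (ler_pM2l d0).
have := le 1 (normr1 _); have := le (-1) (normrN1 _); lra.
Qed.

End comparison.
End layer_cake.

(** * Integration of continuous functions *)

Section borel_integration.
Context (R : realType) (T : topologicalType) (t : T) (mu : set T -> \bar R).
Hypotheses (mu_borel : borel_measure mu) (mu_ge0 : forall A, (0 <= mu A)%E)
  (mu_fin : (mu setT < +oo)%E).

Local Notation S := (borel_type t).

(* The same set function, on the type that carries the Borel sets. *)
Let muS : set S -> \bar R := mu.

Let muS0 : muS set0 = 0%E.
Proof. by case: mu_borel. Qed.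

Let muS_sigma_additive : semi_sigma_additive muS.
Proof.
move=> F mF tF _.
have [_ _ /(_ F mF tF) muF] := mu_borel; rewrite /muS muF.
by apply: is_cvg_nneseries => n _ _; exact: mu_ge0.
Qed.

HB.instance Definition _ := isMeasure.Build _ S R muS
  muS0 mu_ge0 muS_sigma_additive.

Lemma measurable_continuous (f : T -> R) : continuous f ->
  measurable_fun [set: S] (f : S -> R).
Proof.
move=> cf; apply: (measurability _ (RGenOInfty.measurableE R)).
move=> _ [_ [x ->] <-]; rewrite setTI; apply: sub_sigma_algebra.
by move/continuousP : cf; apply; exact: interval_open.
Qed.

Lemma integrable_continuous (f : T -> R) (c : R) : continuous f ->
  (forall x, `|f x| <= c) -> muS.-integrable [set: S] (EFin \o f).
Proof.
move=> cf fc; apply: measurable_bounded_integrable => //.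
  exact: measurable_continuous.
exists c; split; first exact: num_real.
by move=> y cy x _; exact: le_trans (fc x) (ltW cy).
Qed.

Definition borel_Rintegral (f : T -> R) : R :=
  (\int[muS]_(x in [set: S]) f x)%R.

Lemma borel_RintegralE (f : T -> R) (c : R) : continuous f ->
  (forall x, `|f x| <= c) ->
  (borel_Rintegral f)%:E = (\int[mu : set S -> \bar R]_x (f x)%:E)%E.
Proof.
move=> cf fc; rewrite /borel_Rintegral /Rintegral fineK//.
by apply: integrable_fin_num => //; exact: integrable_continuous fc.
Qed.

Lemma borel_Rintegral_linear :
  (forall f : T -> R, continuous f -> exists c, forall x, `|f x| <= c) ->
  linear_on_continuous borel_Rintegral.
Proof.
move=> bnd a f g cf cg; have [c fc] := bnd _ cf; have [d gd] := bnd _ cg.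
have cfi := integrable_continuous cf fc.
have cgi := integrable_continuous cg gd.
rewrite /borel_Rintegral RintegralD// ?RintegralZl//.
exact: (integrableZl measurableT a cfi).
Qed.

Lemma borel_Rintegral1 : (borel_Rintegral (fun=> 1))%:E = mu setT.
Proof.
rewrite (borel_RintegralE (c := 1)) ?normr1//; last exact: continuous_cst_fun.
by rewrite [LHS](integral_cst muS measurableT 1%E) mul1e.
Qed.

Lemma open_le_borel_Rintegral U (g : T -> R) : open U -> continuous g ->
  unit_valued g -> (forall x, U x -> g x = 1) ->
  (mu U <= (borel_Rintegral g)%:E)%E.
Proof.
move=> oU cg ug gU.
have mU : measurable (U : set S) by exact: sub_sigma_algebra.
have g1 x : `|g x| <= 1.
  by have /andP[g0 g1] := ug x; rewrite ger0_norm.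
rewrite (borel_RintegralE cg g1) -[mu U]/(muS U) -[U in muS U]setIT.
rewrite -integral_indic//; apply: ge0_le_integral => //.
- by apply/measurable_EFinP; exact: measurable_indic.
- by apply/measurable_EFinP; exact: measurable_continuous.
- move=> x _; rewrite lee_fin indicE.
  have [/set_mem/gU ->//|_] := boolP (x \in U).
  by case/andP: (ug x).
Qed.

End borel_integration.

(** * Representation of functionals on bounded functions *)

Section bounded_functions.
Context (R : realType) (T : Type).
Implicit Types f g : T -> R.

Definition bounded_function f : Prop := exists c, forall t, `|f t| <= c.

Definition positive_on_bounded (L : (T -> R) -> R) : Prop := [/\
  forall f g, bounded_function f -> bounded_function g ->
    L (fun t => f t + g t) = L f + L g,
  forall a f, bounded_function f -> L (fun t => a * f t) = a * L f
  & forall f, bounded_function f -> (forall t, 0 <= f t) -> 0 <= L f].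

Lemma bounded_functionD f g : bounded_function f -> bounded_function g ->
  bounded_function (fun t => f t + g t).
Proof.
move=> [c fc] [d gd]; exists (c + d) => t.
by apply: (le_trans (ler_normD _ _)); exact: lerD.
Qed.

Lemma bounded_functionZ a f : bounded_function f ->
  bounded_function (fun t => a * f t).
Proof. by move=> [c fc]; exists (`|a| * c) => t; rewrite normrM ler_wpM2l. Qed.

Lemma bounded_cst (c : R) : bounded_function (fun=> c).
Proof. by exists `|c|. Qed.

Lemma bounded_indic (A : set T) : bounded_function (\1_A : T -> R).
Proof.
by exists 1 => t; rewrite indicE; case: (_ \in _); rewrite ?normr1 ?normr0.
Qed.

Section monotone.
Variable L : (T -> R) -> R.
Hypothesis pL : positive_on_bounded L.

Lemma positive_on_bounded_le f g : bounded_function f -> bounded_function g ->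
  (forall t, f t <= g t) -> L f <= L g.
Proof.
have [LD LZ L0] := pL.
move=> bf bg fg; have bNf := bounded_functionZ (-1) bf.
have : 0 <= L (fun t => g t + -1 * f t).
  by apply: L0 => [|t]; [exact: bounded_functionD|rewrite mulN1r subr_ge0].
by rewrite LD// LZ// mulN1r subr_ge0.
Qed.

Lemma indic_content_ge0 (A : set T) : 0 <= L \1_A.
Proof. by have [_ _ L0] := pL; apply: L0 => [|t]; [exact: bounded_indic|]. Qed.

Lemma indic_contentU (A B : set T) : A `&` B = set0 ->
  L \1_(A `|` B) = L \1_A + L \1_B.
Proof.
have [LD _ _] := pL; move=> AB0; rewrite -LD; try exact: bounded_indic.
congr L; apply/funext => t; rewrite !indicE in_setU.
have [/set_mem At|_] := boolP (t \in A);
  have [/set_mem Bt|_] := boolP (t \in B); rewrite ?addr0 ?add0r//.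
by have : (A `&` B) t by []; rewrite AB0.
Qed.

End monotone.
End bounded_functions.

Lemma compact_continuous_bounded (R : realType) (T : topologicalType)
    (f : T -> R) :
  compact [set: T] -> continuous f -> bounded_function f.
Proof.
move=> cT cf; have [[t _]|T0] := pselect (exists t : T, True); last first.
  by exists 0 => t; exfalso; apply: T0; exists t.
have T0 : [set: T] !=set0 by exists t.
have cnf : {within [set: T], continuous (fun t => `|f t|)}.
  by apply: continuous_subspaceT => y; apply: cvg_norm; exact: cf.
have [x _ xmax] := compact_EVT_max T0 cT cnf.
by exists `|f x| => y; apply: xmax; rewrite inE.
Qed.

Section representation.
Context (R : realType) (T : topologicalType) (L : (T -> R) -> R).
Hypotheses (hT : hausdorff_space T) (cT : compact [set: T])
  (pL : positive_on_bounded L).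

Local Notation m := (fun A : set T => L \1_A).
Let m_ge0 := indic_content_ge0 pL.
Let mU := indic_contentU pL.

(** For [d > 0] the closed set [C = {d <= f}] lies in the open support of [f],
    and [f <= \1_C + d]. *)
Lemma le_outer_content_support (f : T -> R) : continuous f -> unit_valued f ->
  ((L f)%:E <= outer_content m [set t | (f t != 0)%R])%E.
Proof.
move=> cf uf; have [LD LZ _] := pL.
have oU : open [set t | f t != 0].
  by have /continuousP/(_ [set y | y != 0]) := cf; apply; exact: open_neq.
have L1 : 0 <= L (fun=> 1).
  by have [_ _ L0] := pL; apply: L0 => //; exact: bounded_cst.
rewrite outer_content_open//; apply/lee_addgt0Pr => e e0.
pose d := e / (L (fun=> 1) + 1).
have d0 : 0 < d by rewrite divr_gt0// ltr_wpDl.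
pose C := [set t | d <= f t].
have cC : closed C.
  by have /continuous_closedP/(_ [set y | d <= y]) := cf; apply;
    exact: closed_ge.
have CU : C `<=` [set t | f t != 0].
  by move=> t /= dft; rewrite gt_eqF// (lt_le_trans d0).
apply: (@le_trans _ _ ((L \1_C)%:E + e%:E)%E); last first.
  by rewrite leeD2r//; apply: le_inner_content.
have bC := @bounded_indic R T C; have b1 := @bounded_cst R T 1.
have bd := bounded_functionZ d b1.
rewrite -EFinD lee_fin; apply: (@le_trans _ _ (L \1_C + d * L (fun=> 1))).
  rewrite -LZ// -LD//; apply: positive_on_bounded_le => //.
  - exact: compact_continuous_bounded.
  - exact: bounded_functionD.
  - move=> t; rewrite mulr1 indicE; have [_|nC] := boolP (t \in C).
      by have /andP[_ f1] := uf t; rewrite (le_trans f1)// lerDl ltW.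
    rewrite add0r leNgt; apply/negP => dft.
    by move: nC; rewrite notin_setE; apply; exact: ltW.
rewrite lerD2l /d mulrAC ler_pdivrMr ?ltr_wpDl// ler_wpM2l ?ltW//.
by rewrite ltrDl.
Qed.

(** The Riesz-Markov theorem, for a functional that is defined on all bounded
    functions: then [A |-> L \1_A] is a finitely additive content on all
    subsets, which replaces the partitions of unity of the usual proof.  Let
    [mu] be its regularisation.  If [g] equals 1 on the open support of [f],
    then [L f] is at most the measure of this support, which is at most the
    integral of [g].  Both functionals have the same total mass, so the
    layer-cake comparison identifies them on continuous functions. *)
Lemma positive_functional_representation : exists mu : set T -> \bar R,
  regular_borel_measure mu /\
  forall f : T -> R, continuous f ->
    (L f)%:E = borel_integral mu (fun t => (f t)%:E).
Proof.
have [LD LZ _] := pL.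
pose mu := outer_content m.
exists mu; split; first exact: outer_content_regular hT cT m_ge0 mU.
have bnd (f : T -> R) : continuous f -> bounded_function f.
  exact: compact_continuous_bounded.
move=> f cf; rewrite /borel_integral; case: pselect => [e|T0]; last first.
  have -> : f = fun t => 0 * f t.
    by apply/funext => t; exfalso; apply: T0; exists t.
  by rewrite LZ ?mul0r//; exact: bnd.
have mub : borel_measure mu := outer_content_borel_measure hT cT m_ge0 mU.
have mu0 : forall A, (0 <= mu A)%E := outer_content_ge0 mU.
have muT : mu setT = (L (fun=> 1))%:E.
  by rewrite /mu outer_contentT// indicT.
have muoo : (mu setT < +oo)%E by rewrite muT ltry.
set t := sval _.
have [c fc] := bnd _ cf.
rewrite -(borel_RintegralE t mub mu0 muoo cf fc); congr (_%:E).
apply: (@layer_cake_eq _ _ _ _ _ _ _ _ c) => //.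
- move=> a g h cg ch; have bg := bnd _ cg; rewrite LD ?LZ//; last exact: bnd.
  exact: bounded_functionZ.
- exact: borel_Rintegral_linear.
- move=> g h cg ch ug uh gh; rewrite -lee_fin.
  apply: (le_trans (le_outer_content_support cg ug)).
  apply: open_le_borel_Rintegral => //.
  by have /continuousP/(_ [set y | y != 0]) := cg; apply; exact: open_neq.
- by rewrite -lee_fin -muT borel_Rintegral1.
Qed.

End representation.

(** * Extension of positive functionals *)

Section positive_extension.
Context (R : realType) (X : lmodType R) (K : set X) (u : X) (T : Type).
Hypothesis hu : order_unit K u.
Variables (i : X -> T -> R) (phi : {scalar X}).
Hypotheses (iD : forall x y t, i (x + y) t = i x t + i y t)
  (iZ : forall a x t, i (a *: x) t = a * i x t)
  (iK : forall x, K x <-> forall t, 0 <= i x t)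
  (iu : forall t, i u t = 1) (phiK : positive_functional K phi).

Lemma functional_unit_le x (l : R) : K (l *: u - x) -> phi x <= l * phi u.
Proof. by move/phiK; rewrite linearB linearZ subr_ge0. Qed.

Lemma functional_vanish x : phi u = 0 -> phi x = 0.
Proof.
move=> u0; have [_ /(_ x)[l [_ lb ub]]] := hu.
have := functional_unit_le ub; have := @functional_unit_le (- x) l.
rewrite opprK addrC u0 mulr0 linearN /=.
move: lb; rewrite /cone_le opprK => lb /(_ lb); lra.
Qed.

(** When [phi u = 0], already [phi = 0].  Otherwise [0 < phi u]; call a function
    positive if it majorises some [i x] with [0 <= phi x].  If the constant
    [- 1] were positive, then [phi u <= 0], so this wedge admits a state [f].
    When [phi x = 0], both [i x] and [i (- x)] are positive, so [f (i x) = 0];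
    hence on the range of [i] the state [f] is a multiple of [phi]. *)
Lemma positive_extension : exists L : (T -> R) -> R,
  positive_on_bounded L /\ forall x, L (i x) = phi x.
Proof.
have [u0|u0] := eqVneq (phi u) 0.
  exists (fun=> 0); split; last by move=> x; rewrite functional_vanish.
  by split=> *; rewrite ?addr0 ?mulr0.
have {}u0 : 0 < phi u by rewrite lt_neqAle eq_sym u0 phiK//; case: hu.
pose V := (T -> R^o) : lmodType R.
pose P := [set f : V | exists2 x, 0 <= phi x & forall t, i x t <= f t].
have i0 t : i 0 t = 0 by rewrite -(scale0r 0) iZ mul0r.
have P_pos (f : V) : (forall t, 0 <= f t) -> P f.
  by move=> f0; exists 0; [rewrite linear0|move=> t; rewrite i0].
have Pi x : 0 <= phi x -> P (i x) by move=> x0; exists x.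
have wP : wedge P.
  split.
  - exact: P_pos.
  - move=> f g [x x0 xf] [y y0 yg]; exists (x + y).
      by rewrite linearD addr_ge0.
    by move=> t; rewrite iD; apply: lerD; [exact: xf|exact: yg].
  - move=> a f a0 [x x0 xf]; exists (a *: x); first by rewrite linearZ mulr_ge0.
    by move=> t; rewrite iZ; apply: ler_wpM2l => //; exact: xf.
pose one : V := fun=> 1.
have Pone : P one by apply: P_pos => t; exact: ler01.
have PNone : ~ P (- one).
  move=> [x x0 xN1].
  have : K ((-1) *: u - x).
    apply/iK => t; rewrite -[- x]scaleN1r iD !iZ iu.
    by have := xN1 t; rewrite /one -[(- _) t]/(- 1 : R); lra.
  by move/functional_unit_le; lra.
have [f [f1 fD fZ fP]] := wedge_state wP Pone PNone.
have bnd (g : V) : bounded_function (g : T -> R) -> order_bounded P one g.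
  move=> [c gc]; exists c; split; apply: P_pos => t.
    rewrite -[X in 0 <= X]/(c * 1 - g t : R).
    by have := gc t; rewrite ler_norml; lra.
  rewrite -[X in 0 <= X]/(c * 1 + g t : R).
  by have := gc t; rewrite ler_norml; lra.
exists (fun g => phi u * f g); split; first split.
- by move=> g h bg bh; rewrite -mulrDr -(fD g h (bnd g bg) (bnd h bh)).
- by move=> a g bg; rewrite mulrCA -(fZ a g (bnd g bg)).
- move=> g bg g0; apply: mulr_ge0; first exact: ltW.
  by apply: fP; [exact: bnd|exact: P_pos].
have bi x : bounded_function (i x).
  have [_ /(_ x)[l [_ lb ub]]] := hu.
  exists l => t; rewrite ler_norml.
  have /iK/(_ t) := lb; have /iK/(_ t) := ub.
  rewrite -[- x]scaleN1r opprK !iD !iZ !iu; lra.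
have f_ge0 x : 0 <= phi x -> 0 <= f (i x).
  by move=> x0; apply: fP; [exact/bnd/bi|exact: Pi].
have f_ker x : phi x = 0 -> f (i x) = 0.
  move=> x0; have := f_ge0 x; rewrite x0 lexx => /(_ isT) p.
  have := f_ge0 (- x); rewrite linearN x0 oppr0 lexx => /(_ isT).
  have -> : i (- x) = (-1) *: (i x : V).
    by apply/funext => t; rewrite -scaleN1r iZ.
  by rewrite fZ; [lra|exact/bnd/bi].
move=> x; pose r := phi x / phi u.
have -> : i x = (i (x - r *: u) : V) + r *: one.
  apply/funext => t; rewrite -[RHS]/(i (x - r *: u) t + r * 1 : R).
  by rewrite -scaleNr iD iZ iu mulNr subrK.
have bone : order_bounded P one one by apply: bnd; exact: bounded_cst.
rewrite fD; last 2 first.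
- exact/bnd/bi.
- by apply: bnd; apply: bounded_functionZ; exact: bounded_cst.
rewrite fZ// f1 mulr1 f_ker ?add0r.
  by rewrite /r mulrCA divff ?mulr1// gt_eqF.
by rewrite linearB linearZ /= /r divfK ?subrr// gt_eqF.
Qed.

End positive_extension.

(** * The functional representation *)

Theorem theorem5p3 (R : realType) (X : lmodType R) (K : set X)
    (hK : is_cone K) (hArch : archimedean_cone K) (hPR : pre_riesz K)
    (hunit : exists u : X, order_unit K u) :
  exists (Omega : topologicalType) (i : {linear X -> continuousType Omega R}),
    [/\ compact [set: Omega],
        hausdorff_space Omega,
        bipositive K (cfun_cone (R := R) (T := Omega)) i,
        order_dense (cfun_cone (R := R) (T := Omega)) (range i) &
        forall phi : {scalar X}, positive_functional K phi ->
          exists mu : set Omega -> \bar R,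
            regular_borel_measure mu /\
            forall x : X,
              (phi x)%:E = borel_integral mu (fun w => (i x w)%:E)].
Proof.
have [u hu] := hunit.
have [U [oU dU peakU]] := minimal_detecting_set hK hArch hu.
pose F : set {ptws X -> R} := states K u `\` U.
pose Omega : topologicalType := set_type F.
have FP (w : Omega) : F (set_val w) by case: w => f Ff; exact: set_mem.
have sP (w : Omega) : states K u (set_val w) by have [] := FP w.
have ce x : continuous (fun w : Omega => set_val w x).
  move=> w; apply: (@continuous_comp _ _ _ (@set_val _ F) (fun f => f x)).
    exact: set_val_continuous.
  exact: continuous_evaluation.
pose i0 (x : X) : continuousType Omega R := mkcts (ce x).
have i0_linear : linear i0.
  move=> a x y; apply/continuousEP => w.
  have [_ fD fZ _] := sP w.
  by rewrite -[LHS]/(set_val w (a *: x + y)) fD fZ.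
pose i : {linear X -> continuousType Omega R} :=
  HB.pack i0
    (GRing.isLinear.Build R X (continuousType Omega R) *:%R i0 i0_linear).
have iE x w : i x w = set_val w x by [].
have cO : compact [set: Omega].
  apply: compact_set_type; apply: compact_closedI; first exact: compact_states.
  exact: open_closedC.
have hO : hausdorff_space Omega.
  apply: hausdorff_set_type; apply: hausdorff_product => x.
  exact: Rhausdorff.
have iK x : K x <-> forall w, 0 <= i x w.
  split=> [Kx w|ix]; first by have [_ _ _ fK] := sP w; exact: fK.
  apply: contrapT => nKx; have [f Ff fx] := dU x nKx.
  have := ix (exist _ f (mem_set Ff)).
  by rewrite iE leNgt fx.
have iu w : i u w = 1 by have [fu _ _ _] := sP w.
exists Omega, i; split => //.
- apply: (order_dense_of_peaks cO iu) => V oV [w Vw].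
  have [W oW WV] := oV.
  have [|x nKx xW] := peakU W oW.
    by exists (set_val w); split; [exact: FP|rewrite -WV in Vw].
  exists x.
    apply: contrapT => nneg; apply: nKx; apply/iK => s.
    by rewrite leNgt; apply/negP => ixs; apply: nneg; exists s.
  move=> s nVs; apply: xW; first exact: FP.
  by move=> Ws; apply: nVs; rewrite -WV.
- move=> phi phiK.
  have [||L [pL LE]] := @positive_extension R X K u Omega hu
    (fun x w => i x w) phi _ _ iK iu phiK.
  + by move=> x y w; rewrite linearD.
  + by move=> a x w; rewrite linearZ.
  have [mu [mu_reg muE]] := positive_functional_representation hO cO pL.
  exists mu; split => // x; rewrite -LE muE//; exact: ce.
Qed.
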